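(* Let $p$ be a prime and let $f\colon \mathbb{Z}_p\to\mathbb{Z}_p$ be a compatible function with coordinate representation $$f(x_0+px_1+\ldots+p^kx_k+\ldots)=\varphi_0(x_0)+p\varphi_1(x_0,x_1)+\ldots+p^k\varphi_k(x_0,x_1,\ldots,x_k)+\ldots ,$$ where $\varphi_0$ and all the maps $\varphi_{k,\bar{x}_{k-1}}$, $k=1,2,\ldots$, are permutations of the set of residues modulo $p$. Then $f$ is ergodic if and only if both of the following hold: (1) $\varphi_0$ is transitive on the set of residues modulo $p$; (2) for every $k=1,2,\ldots$, the permutation $$F_{k,0}=\varphi_{k,f_{k-1}^{(p^k-1)}(0)}\circ\varphi_{k,f_{k-1}^{(p^k-2)}(0)}\circ\ldots\circ\varphi_{k,f_{k-1}(0)}\circ\varphi_{k,0}$$ is transitive on the set of residues modulo $p$.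
   Context: $\mathbb{Z}_p$ is the ring of $p$-adic integers with valuation $|\cdot|_p$ and Haar measure $\mu_p$ normalized by $\mu_p(\mathbb{Z}_p)=1$; ergodicity is with respect to $\mu_p$ (an ergodic map is measure preserving and every invariant measurable set has measure $0$ or $1$). A function $f\colon\mathbb{Z}_p\to\mathbb{Z}_p$ is compatible if $|f(x)-f(y)|_p\le|x-y|_p$ for all $x,y$. Every $x\in\mathbb{Z}_p$ has a canonical expansion $x=x_0+px_1+\ldots$ with $x_i\in\{0,\ldots,p-1\}$; for compatible $f$ the $k$-th base-$p$ digit of $f(x)$ depends only on $x_0,\ldots,x_k$ and is denoted $\varphi_k(x_0,\ldots,x_k)\in\{0,\ldots,p-1\}$ (coordinate representation). The set $\{0,\ldots,p-1\}$ is identified with $\mathbb{Z}/p\mathbb{Z}$. For $\bar{x}_{k-1}=(x_0,\ldots,x_{k-1})\in\{0,\ldots,p-1\}^k$, $\varphi_{k,\bar{x}_{k-1}}$ is the map $x_k\mapsto\varphi_k(x_0,\ldots,x_{k-1},x_k)$ of $\{0,\ldots,p-1\}$ to itself. A vector $\bar{x}_{k-1}$ is identified with the residue $x_0+px_1+\ldots+p^{k-1}x_{k-1}$ modulo $p^k$; in particular $0$ stands for the zero vector. $f_k$ denotes the induced map $x\bmod p^{k+1}\mapsto f(x)\bmod p^{k+1}$, in coordinates $(x_0,\ldots,x_k)\mapsto(\varphi_0(x_0),\ldots,\varphi_k(x_0,\ldots,x_k))$, so $f_0=\varphi_0$; $f_{k-1}^{(s)}$ is the $s$-fold iterate of $f_{k-1}$.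 Here $\circ$ is composition (rightmost factor applied first). A permutation of a finite set is transitive if it consists of a single cycle through all elements. *)

(* Defs.v *)
From HB Require Import structures.
From mathcomp Require Import all_boot all_order all_algebra.
From mathcomp Require Import all_classical all_reals all_analysis.

Set Implicit Arguments.
Unset Strict Implicit.
Unset Printing Implicit Defensive.

Import Order.TTheory GRing.Theory Num.Theory.

Local Open Scope classical_set_scope.
Local Open Scope ring_scope.

(* Z_p as the inverse limit of the rings Z/p^n: an element is the sequence
   x_0, x_1, ... of its least nonnegative residues modulo p^0, p^1, ...
   The construction works for every p; it is only used for p prime. *)
Definition padic_coherent (p : nat) (x : nat -> int) : Prop :=
  forall n, x n = (x n.+1 %% (p ^ n)%N)%Z.

Record padic_int (p : nat) : Type := PadicInt {
  padic_res : nat -> int;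
  _ : `[< padic_coherent p padic_res >] }.

HB.instance Definition _ (p : nat) := [isSub for @padic_res p].
HB.instance Definition _ (p : nat) := [Choice of padic_int p by <:].

Section PadicRing.
Variable p : nat.
Implicit Types x y z : padic_int p.

Lemma padic_resS x n : padic_res x n = (padic_res x n.+1 %% (p ^ n)%N)%Z.
Proof. by case: x => x /asboolP /=. Qed.

Lemma padic_res_mod x n : (padic_res x n %% (p ^ n)%N)%Z = padic_res x n.
Proof. by rewrite padic_resS modz_mod. Qed.

Lemma padic_intP x y : padic_res x =1 padic_res y -> x = y.
Proof. by move=> xy; apply: val_inj; apply/funext. Qed.

Lemma modz_exp_trans (a : int) n :
  ((a %% (p ^ n.+1)%N)%Z %% (p ^ n)%N)%Z = (a %% (p ^ n)%N)%Z.
Proof.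
rewrite [in RHS](divz_eq a (p ^ n.+1)%N) expnS PoszM mulrA.
by rewrite [RHS]modzMDl.
Qed.

Lemma padic_of_coherent (u : nat -> int) :
  (forall n, (u n.+1 %% (p ^ n)%N)%Z = (u n %% (p ^ n)%N)%Z) ->
  `[< padic_coherent p (fun n => (u n %% (p ^ n)%N)%Z) >].
Proof. by move=> Hu; apply/asboolP => n; rewrite modz_exp_trans Hu. Qed.

Definition padic_of (u : nat -> int)
  (Hu : forall n, (u n.+1 %% (p ^ n)%N)%Z = (u n %% (p ^ n)%N)%Z) :
  padic_int p := PadicInt (padic_of_coherent Hu).

Lemma padic_zero_coh n : ((0 : int) %% (p ^ n)%N)%Z = (0 %% (p ^ n)%N)%Z.
Proof. by []. Qed.
Lemma padic_one_coh n : ((1 : int) %% (p ^ n)%N)%Z = (1 %% (p ^ n)%N)%Z.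
Proof. by []. Qed.
Lemma padic_opp_coh x n : ((- padic_res x n.+1) %% (p ^ n)%N)%Z =
  ((- padic_res x n) %% (p ^ n)%N)%Z.
Proof. by rewrite (padic_resS x n) modzNm. Qed.
Lemma padic_add_coh x y n :
  ((padic_res x n.+1 + padic_res y n.+1) %% (p ^ n)%N)%Z =
  ((padic_res x n + padic_res y n) %% (p ^ n)%N)%Z.
Proof. by rewrite (padic_resS x n) (padic_resS y n) modzDm. Qed.
Lemma padic_mul_coh x y n :
  ((padic_res x n.+1 * padic_res y n.+1) %% (p ^ n)%N)%Z =
  ((padic_res x n * padic_res y n) %% (p ^ n)%N)%Z.
Proof. by rewrite (padic_resS x n) (padic_resS y n) modzMm. Qed.

Definition padic_zero := padic_of padic_zero_coh.
Definition padic_one := padic_of padic_one_coh.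
Definition padic_opp x := padic_of (padic_opp_coh x).
Definition padic_add x y := padic_of (padic_add_coh x y).
Definition padic_mul x y := padic_of (padic_mul_coh x y).

Lemma padic_addA : associative padic_add.
Proof. by move=> x y z; apply: padic_intP => n /=; rewrite modzDml modzDmr addrA. Qed.
Lemma padic_addC : commutative padic_add.
Proof. by move=> x y; apply: padic_intP => n /=; rewrite addrC. Qed.
Lemma padic_add0 : left_id padic_zero padic_add.
Proof. by move=> x; apply: padic_intP => n /=; rewrite modzDml add0r padic_res_mod. Qed.
Lemma padic_addN : left_inverse padic_zero padic_opp padic_add.
Proof. by move=> x; apply: padic_intP => n /=; rewrite modzDml addNr. Qed.
Lemma padic_mulA : associative padic_mul.
Proof. by move=> x y z; apply: padic_intP => n /=; rewrite modzMml modzMmr mulrA. Qed.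
Lemma padic_mulC : commutative padic_mul.
Proof. by move=> x y; apply: padic_intP => n /=; rewrite mulrC. Qed.
Lemma padic_mul1 : left_id padic_one padic_mul.
Proof. by move=> x; apply: padic_intP => n /=; rewrite modzMml mul1r padic_res_mod. Qed.
Lemma padic_mulDl : left_distributive padic_mul padic_add.
Proof.
by move=> x y z; apply: padic_intP => n /=; rewrite modzMml modzDml modzDmr mulrDl.
Qed.

HB.instance Definition _ := GRing.isZmodule.Build (padic_int p)
  padic_addA padic_addC padic_add0 padic_addN.
HB.instance Definition _ := GRing.Zmodule_isComPzRing.Build (padic_int p)
  padic_mulA padic_mulC padic_mul1 padic_mulDl.
HB.instance Definition _ := isPointed.Build (padic_int p) 0.

Lemma padic_res0 n : padic_res (0 : padic_int p) n = 0.
Proof. by rewrite /= mod0z. Qed.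
Lemma padic_resD x y n :
  padic_res (x + y) n = ((padic_res x n + padic_res y n) %% (p ^ n)%N)%Z.
Proof. by []. Qed.
Lemma padic_resN x n : padic_res (- x) n = ((- padic_res x n) %% (p ^ n)%N)%Z.
Proof. by []. Qed.
Lemma padic_resM x y n :
  padic_res (x * y) n = ((padic_res x n * padic_res y n) %% (p ^ n)%N)%Z.
Proof. by []. Qed.

(* |x|_p = p^-v, where v is the least n with x <> 0 modulo p^(n+1), that is,
   the largest n such that p^n divides x. *)
Definition padic_norm x : rat :=
  match pselect (exists n, padic_res x n.+1 != 0) with
  | left nz => (p%:R ^+ ex_minn nz)^-1
  | right _ => 0
  end.

Lemma padic_res_eq0 x n m : (n <= m)%N -> padic_res x m = 0 -> padic_res x n = 0.
Proof.
elim: m => [|m IH]; first by rewrite leqn0 => /eqP ->.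
rewrite leq_eqVlt => /predU1P[-> //|]; rewrite ltnS => nm xm.
by apply: IH => //; rewrite padic_resS xm mod0z.
Qed.

Lemma padic_normP x :
  (x = 0 /\ padic_norm x = 0) \/
  exists n, [/\ padic_norm x = (p%:R ^+ n)^-1, padic_res x n = 0,
                padic_res x n.+1 != 0 & 0 < padic_norm x].
Proof.
rewrite /padic_norm; case: pselect => [nz|z]; last first.
  left; split=> //; apply: padic_intP => n; rewrite padic_res0.
  apply/eqP; apply: contrapT => /negP xn; apply: z; exists n.
  by apply: contra xn => /eqP xn; apply/eqP; apply: padic_res_eq0 xn.
right; case: ex_minnP => n xn nmin; exists n.
have x0 : padic_res x n = 0.
  case: n {xn} nmin => [_|n nmin]; first by rewrite padic_resS expn0 modz1.
  by apply/eqP; apply: contraT => xn; have := nmin _ xn; rewrite ltnn.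
split=> //; rewrite invr_gt0; case: n x0 xn {nmin} => [//|n] x0 xn.
rewrite exprn_gt0 // ltr0n lt0n; apply: contraNneq xn => p0.
have pn0 : (p ^ n.+1)%N = 0%N by apply/eqP; rewrite expn_eq0 p0.
by move: x0; rewrite padic_resS pn0 modz0 => ->.
Qed.

Lemma padic_norm_ge0 x : 0 <= padic_norm x.
Proof. by case: (padic_normP x) => [[_ ->//]|[n [_ _ _ /ltW]]]. Qed.

Lemma padic_norm0 : padic_norm 0 = 0.
Proof.
case: (padic_normP 0) => [[]//|[n [_ _]]].
by rewrite padic_res0 eqxx.
Qed.

Lemma padic_norm_eq0 x : padic_norm x = 0 -> x = 0.
Proof.
by case: (padic_normP x) => [[]//|[n [_ _ _ +]]] => /[swap] ->; rewrite ltxx.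
Qed.

Lemma padic_norm_antimono n m : (m <= n)%N ->
  (p%:R ^+ n)^-1 <= (p%:R ^+ m)^-1 :> rat.
Proof.
case: (posnP p) => [->|p0] mn.
  case: m mn => [|m] mn; last by case: n mn => // n _; rewrite !expr0n.
  by case: n {mn} => [|n]; rewrite ?lexx // [0 ^+ n.+1]expr0n /= invr0 expr0 invr1.
by rewrite lef_pV2 ?posrE ?exprn_gt0 ?ltr0n // ler_weXn2l ?ler1n.
Qed.

Lemma padic_norm_ub x n : padic_res x n.+1 != 0 ->
  (p%:R ^+ n)^-1 <= padic_norm x.
Proof.
case: (padic_normP x) => [[-> _]|[m [-> xm _ _] xn]].
  by rewrite padic_res0 eqxx.
apply: padic_norm_antimono; rewrite leqNgt; apply: contra xn => nm.
exact/eqP/(padic_res_eq0 nm).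
Qed.

Lemma padic_normD x y :
  padic_norm (x + y) <= Num.max (padic_norm x) (padic_norm y).
Proof.
case: (padic_normP (x + y)) => [[_ ->]|[n [-> _ xyn _]]].
  by rewrite le_max padic_norm_ge0.
rewrite le_max; have [xn|/padic_norm_ub -> //] := eqVneq (padic_res x n.+1) 0.
have [yn|/padic_norm_ub ->] := eqVneq (padic_res y n.+1) 0; last exact: orbT.
by move: xyn; rewrite padic_resD xn yn addr0 mod0z eqxx.
Qed.

Lemma padic_resN_eq0 x n : padic_res x n = 0 -> padic_res (- x) n = 0.
Proof. by rewrite padic_resN => ->; rewrite oppr0 mod0z. Qed.

Lemma padic_normN x : padic_norm (- x) = padic_norm x.
Proof.
wlog suff le : x / padic_norm (- x) <= padic_norm x.
  by apply/eqP; rewrite eq_le le /=; have := le (- x); rewrite opprK.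
case: (padic_normP (- x)) => [[_ ->]|[n [-> _ xn _]]].
  exact: padic_norm_ge0.
by apply: padic_norm_ub; apply: contra xn => /eqP/padic_resN_eq0 ->.
Qed.

Lemma padic_distxx x : padic_norm (x - x) = 0.
Proof. by rewrite subrr padic_norm0. Qed.
Lemma padic_dist_eq0 x y : padic_norm (x - y) = 0 -> x = y.
Proof. by move/padic_norm_eq0/eqP; rewrite subr_eq0 => /eqP. Qed.
Lemma padic_distC x y : padic_norm (x - y) = padic_norm (y - x).
Proof. by rewrite -padic_normN opprB. Qed.
Lemma padic_dist_triangle y x z :
  padic_norm (x - z) <= padic_norm (x - y) + padic_norm (y - z).
Proof.
rewrite -[x - z](subrKA y); apply: le_trans (padic_normD _ _) _.
by rewrite ge_max lerDl lerDr !padic_norm_ge0.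
Qed.

HB.instance Definition _ := isMetric.Build rat (padic_int p)
  padic_distxx padic_dist_eq0 padic_distC padic_dist_triangle.

(* The k-th digit of the canonical expansion; for p prime, 'F_p is the set
   {0, ..., p-1} and the cast below does not reduce anything. *)
Definition padic_digit (k : nat) (x : padic_int p) : 'F_p :=
  (padic_res x k.+1 %/ (p ^ k)%N)%Z%:~R.

End PadicRing.

Lemma padic_expansion (p : nat) (p_pr : prime p) (x : padic_int p) (n : nat) :
  padic_res x n = (\sum_(i < n) padic_digit i x * p ^ i)%N.
Proof.
have p0 := prime_gt0 p_pr; have pn0 k : (p ^ k)%N%:Z != 0.
  by rewrite eqz_nat -lt0n expn_gt0 p0.
elim: n => [|n IH]; first by rewrite big_ord0 padic_resS expn0 modz1.
rewrite big_ord_recr /= PoszD -IH [in RHS](padic_resS x n).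
rewrite {1}(divz_eq (padic_res x n.+1) (p ^ n)%N) addrC; congr (_ + _).
rewrite PoszM; congr (_ * _); rewrite /padic_digit.
set q := (_ %/ _)%Z.
have q0 : 0 <= q.
  by rewrite divz_ge0 ?ltz_nat ?expn_gt0 ?p0 // -padic_res_mod modz_ge0.
have qp : q < p%:Z.
  rewrite ltz_divLR ?ltz_nat ?expn_gt0 ?p0 // -PoszM -expnS -padic_res_mod.
  by rewrite ltz_pmod // ltz_nat expn_gt0 p0.
case: q q0 qp => // q _ qp; rewrite -pmulrn /= val_Fp_nat //.
by rewrite modn_small // -ltz_nat.
Qed.

(* The Borel sigma-algebra of Z_p. *)
Notation padic_borel p := (g_sigma_algebraType (@open (padic_int p))).

(* A normalised Haar measure: by uniqueness of the Haar measure, these two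
   properties (total mass 1, invariance) determine mu. *)
Definition haar_probability (p : nat) (R : realType)
    (mu : probability (padic_borel p) R) : Prop :=
  forall (a : padic_int p) (A : set (padic_borel p)), measurable A ->
    mu [set a + x | x in A] = mu A.

Definition measure_preserving d (T : measurableType d) (R : realType)
    (mu : {measure set T -> \bar R}) (f : T -> T) : Prop :=
  measurable_fun setT f /\
  forall A : set T, measurable A -> mu (f @^-1` A) = mu A.

Definition ergodic d (T : measurableType d) (R : realType)
    (mu : {measure set T -> \bar R}) (f : T -> T) : Prop :=
  measure_preserving mu f /\
  forall A : set T, measurable A -> f @^-1` A = A ->
    mu A = 0%E \/ mu A = 1%E.

Definition compatible (p : nat) (f : padic_int p -> padic_int p) : Prop :=
  forall x y, padic_norm (f x - f y) <= padic_norm (x - y).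

Section Coordinates.
Variable p : nat.
Implicit Types (phi : forall k, k.+1.-tuple 'F_p -> 'F_p) (k : nat).

Definition coordinate_representation (f : padic_int p -> padic_int p) phi :=
  forall (x : padic_int p) k,
    padic_digit k (f x) = phi k [tuple padic_digit i x | i < k.+1].

(* phi_{k,a}; for k = 0 the vector a is empty and this is phi_0. *)
Definition subcoordinate phi k (a : k.-tuple 'F_p) : 'F_p -> 'F_p :=
  fun t => phi k [tuple of rcons a t].

(* The map induced by f modulo p^k on vectors of k digits, written f_{k-1}
   when k > 0. *)
Definition induced_map phi k (a : k.-tuple 'F_p) : k.-tuple 'F_p :=
  [tuple phi i [tuple tnth a (widen_ord (ltn_ord i) j) | j < i.+1] | i < k].

(* phi_{k, g^(n-1)(a)} \o ... \o phi_{k, g(a)} \o phi_{k, a}, where g is the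
   map induced by f modulo p^k. *)
Fixpoint subcoordinate_comp phi k (a : k.-tuple 'F_p) (n : nat) : 'F_p -> 'F_p :=
  if n is m.+1 then
    subcoordinate phi (iter m (@induced_map phi k) a)
      \o subcoordinate_comp phi a m
  else id.

(* F_{k,a}: the first return of f to the ball a + p^k Z_p, read on the k-th
   digit, when f is transitive modulo p^k. *)
Definition fibre_return_map phi k (a : k.-tuple 'F_p) : 'F_p -> 'F_p :=
  subcoordinate_comp phi a (p ^ k).

End Coordinates.

(* g permutes T in a single cycle passing through all the elements. *)
Definition transitive_perm (T : finType) (g : T -> T) : Prop :=
  exists2 c : seq T, ufcycle g c & forall x, x \in c.

(* Main.v *)
Require Import Defs.
From mathcomp Require Import all_boot all_order all_algebra.
From mathcomp Require Import all_classical all_reals all_analysis.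

Set Implicit Arguments.
Unset Strict Implicit.
Unset Printing Implicit Defensive.

Import Order.TTheory GRing.Theory Num.Theory.

Local Open Scope classical_set_scope.
Local Open Scope ring_scope.

(* The map f acts on the cylinders of level k (residues modulo p^k) through the
   bijection g_k = induced_map phi k.
   If f is ergodic, the union of the cylinders in a g_k-orbit is invariant of
   positive measure, so g_k is transitive. Conversely, if every g_k is
   transitive and A is invariant, then B |-> mu (A `&` B) gives the same mass
   to all the cylinders of a given level, hence equals mu A * mu B for every
   Borel set B; taking B = A gives mu A = (mu A)^2.
   Finally g_(k+1) is a skew product over g_k whose first return map to the
   fibre of 0 is F_{k,0}, so g_(k+1) is transitive if and only if g_k and
   F_{k,0} are; phi_0 is F_{0,0}. *)

(** * Transitive permutations of a finite set *)

Definition transitive_from (T : Type) (g : T -> T) (x : T) : Prop :=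
  forall y, exists n, iter n g x = y.

(** Under an injective map of a finite type every point is periodic, so the forward orbit of [x]
    closes up into a cycle. *)
Lemma transitive_permP (T : finType) (g : T -> T) (x : T) : injective g ->
  transitive_perm g <-> transitive_from g x.
Proof.
move=> g_inj; split=> [[c /andP[gc _] cT] y|g_tr].
  exists (findex g x y); apply: iter_findex.
  by rewrite (fconnect_cycle gc) ?cT.
exists (orbit g x); first by rewrite /ucycle cycle_orbit // orbit_uniq.
by move=> y; have [n <-] := g_tr y; rewrite -fconnect_orbit fconnect_iter.
Qed.

(** The orbit of [x] fills [T], so its period is [#|T|], and the iterates before that time are
    distinct. *)
Lemma iter_fixed_dvdn (T : finType) (g : T -> T) (x : T) (n : nat) :
  injective g -> transitive_from g x ->
  (iter n g x == x) = (#|T| %| n)%N.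
Proof.
move=> g_inj g_tr; have <- : order g x = #|T|.
  by apply: eq_card => y; have [m <-] := g_tr y; rewrite [LHS]fconnect_iter.
have iter_mul q : iter (q * order g x) g x = x.
  by elim: q => // q IH; rewrite mulSn iterD IH iter_order.
have xn : iter n g x = iter (n %% order g x) g x.
  by rewrite {1}(divn_eq n (order g x)) addnC iterD iter_mul.
apply/eqP/idP => [fix_x|/dvdnP[q ->]]; last exact: iter_mul.
(* Below the period [findex] reads the exponent off the iterate, so a return to [x] forces the
   remainder to be 0. *)
have lt_r : (n %% order g x < order g x)%N by rewrite ltn_mod order_gt0.
by rewrite /dvdn -(findex_iter lt_r) -xn fix_x findex0.
Qed.

Lemma tuple_rconsP (T : Type) k (b : k.+1.-tuple T) :
  exists (a : k.-tuple T) t, b = [tuple of rcons a t].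
Proof.
case: b => s; case/lastP: s => [//|s t] s_size.
have s_k : size s == k by move: s_size; rewrite size_rcons eqSS.
by exists (Tuple s_k), t; apply: val_inj.
Qed.

(** * Induced maps as skew products, and return maps to a fibre *)

Section SkewProduct.
Variables (p : nat) (phi : forall k, k.+1.-tuple 'F_p -> 'F_p).

(** Digit [i] of the image is computed from the digits up to [i], so only the last digit of the
    image sees [t]. *)
Lemma induced_map_rcons k (a : k.-tuple 'F_p) (t : 'F_p) :
  induced_map phi [tuple of rcons a t] =
  [tuple of rcons (induced_map phi a) (subcoordinate phi a t)].
Proof.
apply: eq_from_tnth => i; rewrite tnth_mktuple.
transitivity (nth t (rcons (induced_map phi a) (subcoordinate phi a t)) i);
  last exact/esym/tnth_nth.
have sizeE : size (induced_map phi a) = k by exact: size_tuple.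
rewrite nth_rcons sizeE; have := ltn_ord i; rewrite ltnS leq_eqVlt.
case/predU1P => [ik|ik]; last first.
  rewrite ik -[X in nth _ _ X]/(nat_of_ord (Ordinal ik)) -tnth_nth tnth_mktuple.
  congr (phi _); apply: eq_from_tnth => j; rewrite !tnth_mktuple.
  rewrite !(tnth_nth t) /= nth_rcons size_tuple.
  by rewrite (leq_trans (ltn_ord j)).
have -> : (i < k)%N = false by rewrite ik ltnn.
have -> : (nat_of_ord i == k) = true by apply/eqP.
rewrite /subcoordinate; case: i ik => i lti /= ik.
subst i; congr (phi _); apply: eq_from_tnth => j.
by rewrite !tnth_mktuple !(tnth_nth t).
Qed.

Lemma iter_induced_map_rcons k (a : k.-tuple 'F_p) (t : 'F_p) n :
  iter n (@induced_map p phi k.+1) [tuple of rcons a t] =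
  [tuple of rcons (iter n (@induced_map p phi k) a)
                  (subcoordinate_comp phi a n t)].
Proof.
elim: n => [|n IH] /=; first exact: val_inj.
by rewrite IH induced_map_rcons.
Qed.

Hypothesis phi_inj : forall k (a : k.-tuple 'F_p),
  injective (subcoordinate phi a).

Lemma subcoordinate_comp_inj k (a : k.-tuple 'F_p) n :
  injective (subcoordinate_comp phi a n).
Proof. by elim: n => [//|n IH] /=; apply: inj_comp. Qed.

(** In a skew product, injectivity of the base map and of each fibre map gives injectivity of the
    whole, by induction on the level. *)
Lemma induced_map_inj k : injective (@induced_map p phi k).
Proof.
elim: k => [|k IH] a b; first by rewrite [a]tuple0 [b]tuple0.
have [a' [s ->]] := tuple_rconsP a; have [b' [t ->]] := tuple_rconsP b.
rewrite !induced_map_rcons => /(congr1 val)/= /rcons_inj[ab st].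
have ab' : a' = b' by apply: IH; apply: val_inj.
by apply: val_inj => /=; move: st; rewrite ab' => /phi_inj ->.
Qed.

Hypothesis p_pr : prime p.

(** The base cycle has length [p ^ k], so each block of [p ^ k] steps brings [a] back and applies
    the return map once to the last digit. *)
Lemma iter_return_map k (a : k.-tuple 'F_p) (t : 'F_p) n :
  transitive_from (@induced_map p phi _) a ->
  iter (n * p ^ k) (@induced_map p phi k.+1) [tuple of rcons a t] =
  [tuple of rcons a (iter n (fibre_return_map phi a) t)].
Proof.
move=> a_tr; elim: n => [|n IH] /=; first exact: val_inj.
rewrite mulSn iterD IH iter_induced_map_rcons; apply: val_inj => /=.
congr (rcons (val _) _); apply/eqP.
by rewrite iter_fixed_dvdn ?card_tuple ?card_Fp //; exact: induced_map_inj.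
Qed.

Lemma transitive_from_rcons k (a : k.-tuple 'F_p) (t : 'F_p) :
  transitive_from (@induced_map p phi _) [tuple of rcons a t] <->
  transitive_from (@induced_map p phi _) a /\
  transitive_perm (fibre_return_map phi a).
Proof.
have F_inj := @subcoordinate_comp_inj k a (p ^ k).
rewrite (transitive_permP t F_inj); split=> [at_tr|[a_tr F_tr] b].
  have a_tr : transitive_from (@induced_map p phi _) a.
    move=> b; have [n] := at_tr [tuple of rcons b t].
    rewrite iter_induced_map_rcons => /(congr1 val)/= /rcons_inj[ab _].
    by exists n; apply: val_inj.
  split=> // s; have [m] := at_tr [tuple of rcons a s].
  rewrite iter_induced_map_rcons => /(congr1 val)/= /rcons_inj[/val_inj am ms].
  (* The orbit meets the fibre over [a] only at multiples of [p ^ k], hence only through iterates of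
     the return map. *)
  have /dvdnP[n mE] : (p ^ k %| m)%N.
    move/eqP: am; rewrite iter_fixed_dvdn //; last exact: induced_map_inj.
    by rewrite card_tuple card_Fp.
  exists n; move: (iter_return_map t n a_tr); rewrite -mE.
  rewrite iter_induced_map_rcons => /(congr1 val)/= /rcons_inj[_ <-].
  exact: ms.
have [b' [s ->]] := tuple_rconsP b; have [m mb'] := a_tr b'.
(* [h] inverts the fibre map along the [m] steps from [a] to [b']. The orbit first moves [t] to
   [h s] within the fibre over [a], then goes to [s] over [b']. *)
have [h hK hK'] := injF_bij (@subcoordinate_comp_inj k a m).
have [n nhs] := F_tr (h s); exists (m + n * p ^ k)%N.
rewrite iterD (iter_return_map _ _ a_tr) nhs iter_induced_map_rcons mb' hK'.
exact: val_inj.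
Qed.

(** Induction on the level, appending the digit 0 to the base point; at level 0 the empty vector is
    the only point. *)
Lemma transitive_from_fibres :
  (forall k,
    transitive_from (@induced_map p phi _) [tuple of nseq k (0 : 'F_p)]) <->
  (forall k, transitive_perm (fibre_return_map phi [tuple of nseq k 0])).
Proof.
have nseq_rcons k : [tuple of nseq k.+1 (0 : 'F_p)] =
    [tuple of rcons [tuple of nseq k (0 : 'F_p)] 0].
  by apply: val_inj => /=; elim: k => //= k ->.
split=> [g_tr k|F_tr].
  by have := g_tr k.+1; rewrite nseq_rcons => /transitive_from_rcons[].
elim=> [|k IH]; last by rewrite nseq_rcons; apply/transitive_from_rcons.
by move=> b; exists 0%N; rewrite [b]tuple0 [LHS]tuple0.
Qed.

End SkewProduct.

(** * Cylinders and the Borel sets of the p-adic integers *)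

Section Cylinders.
Variable p : nat.
Hypothesis p_pr : prime p.
Implicit Types x y z : padic_int p.

Lemma padic_resB_eq0 x y n :
  padic_res (x - y) n = 0 <-> padic_res x n = padic_res y n.
Proof.
rewrite padic_resD padic_resN modzDmr; split=> [/eqP xy|->]; last first.
  by rewrite subrr mod0z.
apply/eqP; rewrite -(padic_res_mod x) -(padic_res_mod y) eqz_mod_dvd.
exact/dvdz_mod0P/eqP.
Qed.

Lemma padic_norm_lt_exp x n :
  padic_norm x < (p%:R ^+ n)^-1 -> padic_res x n.+1 = 0.
Proof.
by apply: contraPeq => xn; apply/negP; rewrite -leNgt padic_norm_ub.
Qed.

Lemma padic_norm_le_exp x n :
  padic_res x n = 0 -> padic_norm x <= (p%:R ^+ n)^-1.
Proof.
case: (padic_normP x) => [[_ ->] _|[m [-> _ xm _]] xn].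
  by rewrite invr_ge0 exprn_ge0 // ler0n.
apply: padic_norm_antimono; rewrite leqNgt; apply: contra xm => mn.
exact/eqP/(padic_res_eq0 mn).
Qed.

Definition digits k x : k.-tuple 'F_p := [tuple padic_digit i x | i < k].

Lemma eq_digits k x y : digits k x = digits k y <-> padic_res (x - y) k = 0.
Proof.
split=> [xy|xy].
  apply/padic_resB_eq0; rewrite !padic_expansion //; congr Posz.
  by apply: eq_bigr => i _; have := congr1 (fun t => tnth t i) xy;
    rewrite !tnth_mktuple => ->.
apply: eq_from_tnth => i; rewrite !tnth_mktuple /padic_digit.
have /padic_resB_eq0 -> // : padic_res (x - y) i.+1 = 0.
exact: padic_res_eq0 xy.
Qed.

(** By counting: the integers below [p ^ k] have distinct digit vectors, and there are [p ^ k]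
    vectors. *)
Lemma digits_surj k (a : k.-tuple 'F_p) : exists x, digits k x = a.
Proof.
have p_gt0 := prime_gt0 p_pr.
have coh (m : nat) n : (m%:Z %% (p ^ n)%N)%Z = (m%:Z %% (p ^ n)%N)%Z by [].
pose h (m : 'I_(p ^ k)) := digits k (padic_of (coh m)).
have h_inj : injective h.
  move=> m n /eq_digits/padic_resB_eq0 /=; rewrite !modz_nat !modn_small //.
  by case=> mn; apply: val_inj.
have /codomP[m ->] : a \in codom h.
  by apply: inj_card_onto => //; rewrite card_tuple card_Fp // card_ord.
by exists (padic_of (coh m)).
Qed.

(** For prime [p] this is a residue class modulo [p ^ k], that is, a closed ball of radius
    $p^{-k}$. *)
Definition cylinder k (a : k.-tuple 'F_p) : set (padic_borel p) :=
  digits k @^-1` [set a].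

Lemma open_cylinder k (a : k.-tuple 'F_p) :
  open (cylinder a : set (padic_int p)).
Proof.
rewrite openE => x xa; apply/nbhs_ballP; exists (p%:R ^+ k)^-1 => /=.
  by rewrite invr_gt0 exprn_gt0 // ltr0n prime_gt0.
move=> y; rewrite ballEmdist => /padic_norm_lt_exp xy.
rewrite /cylinder /= -xa; apply/esym/eq_digits.
exact: padic_res_eq0 xy.
Qed.

Lemma measurable_cylinder k (a : k.-tuple 'F_p) : measurable (cylinder a).
Proof. by apply: sub_sigma_algebra; exact: open_cylinder. Qed.

Lemma measurable_digits k (D : set (k.-tuple 'F_p)) :
  measurable (digits k @^-1` D : set (padic_borel p)).
Proof.
rewrite [X in measurable X](_ : _ = \bigcup_(a in D) cylinder a).
  by apply: fin_bigcup_measurable => // a _; exact: measurable_cylinder.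
apply/seteqP; split=> [x Dx|x [a Da]]; first by exists (digits k x).
by rewrite /cylinder /= => ->.
Qed.

(** The empty set is included to make the family closed under intersection. *)
Definition cylinders : set (set (padic_borel p)) :=
  [set A | A = set0 \/ exists k (a : k.-tuple 'F_p), A = cylinder a].

Lemma cylinders_setT : cylinders setT.
Proof.
right; exists 0%N, [tuple]; apply/seteqP; split=> // x _.
exact: (tuple0 (digits 0 x)).
Qed.

(** Two cylinders are either nested or disjoint. *)
Lemma cylinders_setI : setI_closed cylinders.
Proof.
move=> A B [->|[k [a ->]]] [->|[l [b ->]]]; rewrite ?set0I ?setI0; try by left.
wlog kl : k l a b / (k <= l)%N.
  move=> H; case/orP: (leq_total k l) => kl; first exact: H.
  by rewrite setIC; apply: H.
have [[x [xa xb]]|ab0] := pselect (cylinder a `&` cylinder b !=set0);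
  last first.
  by left; apply: contrapT => /eqP/set0P.
right; exists l, b; apply/seteqP; split=> [y []//|y yb]; split=> //.
rewrite /cylinder /= -xa; apply/eq_digits.
by apply: (padic_res_eq0 kl); apply/eq_digits; rewrite yb.
Qed.

Lemma exists_invexp_lt (e : rat) : 0 < e -> exists k, (p%:R ^+ k)^-1 < e.
Proof.
move=> e0; exists (Num.bound e^-1); have p_gt0 := prime_gt0 p_pr.
rewrite invf_plt ?posrE ?exprn_gt0 ?ltr0n //.
apply: lt_le_trans (archi_boundP _) _; first by rewrite invr_ge0 ltW.
by rewrite -natrX ler_nat ltnW // ltn_expl // prime_gt1.
Qed.

Lemma open_bigcup_cylinder (U : set (padic_int p)) : open U ->
  U = \bigcup_(ka in [set ka : {k : nat & k.-tuple 'F_p} |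
        cylinder (tagged ka) `<=` U]) cylinder (tagged ka).
Proof.
move=> oU; apply/seteqP; split=> [x Ux|x [ka kaU] /kaU //].
have /nbhs_ballP[e /= e0 eU] : nbhs x U by move: oU; rewrite openE => /(_ x Ux).
have [k ke] := exists_invexp_lt e0.
exists (Tagged (fun k => k.-tuple 'F_p) (digits k x)) => //= y yx.
apply: eU; rewrite ballEmdist /=; apply: le_lt_trans ke.
by apply: padic_norm_le_exp; apply/eq_digits.
Qed.

(** Digit vectors of all lengths form a countable type, so every open set is a countable union of
    cylinders. *)
Lemma borel_cylinders : @measurable _ (padic_borel p) = <<s cylinders >>.
Proof.
apply/seteqP; split; last first.
  apply: smallest_sub; first exact: sigma_algebra_measurable.
  by move=> _ [->|[k [a ->]]]; [exact: measurable0|exact: measurable_cylinder].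
apply: smallest_sub; first exact: smallest_sigma_algebra.
move=> U /open_bigcup_cylinder ->; rewrite bigcup_mkcond.
pose T := g_sigma_algebraType cylinders.
apply: (@countable_bigcupT_measurable _ T) => [|ka]; first exact: countableP.
case: ifP => _; last exact: measurable0.
by apply: sub_sigma_algebra; right; exists (tag ka), (tagged ka).
Qed.

End Cylinders.

(** * Measures giving equal mass to cylinders of equal level *)

Section UniformMeasures.
Variables (R : realType) (p : nat).
Hypothesis p_pr : prime p.

Definition uniform_on_cylinders (nu : set (padic_borel p) -> \bar R) : Prop :=
  forall k (a b : k.-tuple 'F_p), nu (cylinder a) = nu (cylinder b).

Lemma measure_setT_cylinder (nu : {measure set (padic_borel p) -> \bar R}) k
    (a : k.-tuple 'F_p) :
  uniform_on_cylinders nu -> nu setT = nu (cylinder a) *+ (p ^ k)%N.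
Proof.
move=> nu_unif.
have -> : setT = \bigcup_(b in [set: k.-tuple 'F_p]) cylinder b.
  by apply/seteqP; split=> // x _; exists (digits k x).
rewrite measure_fin_bigcup; last 3 first.
- exact: finite_finset.
- by move=> b c _ _ [x []]; rewrite /cylinder /= => -> ->.
- by move=> b _; exact: measurable_cylinder.
rewrite (@fsbigE _ _ _ _ _ (enum {: k.-tuple 'F_p})) ?enum_uniq //; last first.
  by move=> b _; rewrite mem_enum.
under eq_bigl do rewrite in_setT.
rewrite (eq_bigr (fun=> nu (cylinder a))) => [|b _]; last exact: nu_unif.
by rewrite big_enum /= sumr_const card_tuple card_Fp.
Qed.

(** Translation by [x - y] carries the cylinder of [y] onto that of [x]. *)
Lemma haar_uniform (mu : probability (padic_borel p) R) :
  haar_probability mu -> uniform_on_cylinders mu.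
Proof.
move=> mu_haar k a b; have [x <-] := digits_surj p_pr a.
have [y <-] := digits_surj p_pr b.
rewrite -[RHS](mu_haar (x - y)); last exact: measurable_cylinder.
congr (mu _); apply/seteqP; split=> [z zx|_ [z zy <-]].
  exists (z - (x - y)); last exact: (subrKC (x - y) (z : padic_int p)).
  apply/eq_digits => //; have -> : z - (x - y) - y = z - x :> padic_int p.
    by rewrite opprB addrA addrAC addrK.
  exact/eq_digits.
apply/eq_digits => //; have -> : x - y + z - x = z - y :> padic_int p.
  by rewrite addrAC [x - y]addrC addrK addrC.
exact/eq_digits.
Qed.

Lemma probability_cylinder (mu : probability (padic_borel p) R) k
    (a : k.-tuple 'F_p) :
  uniform_on_cylinders mu -> mu (cylinder a) *+ (p ^ k)%N = 1%E.
Proof.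
move=> mu_unif; rewrite -(probability_setT mu).
exact/esym/measure_setT_cylinder.
Qed.

Lemma cylinder_measure_gt0 (mu : probability (padic_borel p) R) k
    (a : k.-tuple 'F_p) : uniform_on_cylinders mu -> (0 < mu (cylinder a))%E.
Proof.
move=> /(probability_cylinder a) mu_a; rewrite lt0e measure_ge0 andbT.
apply/eqP => mu_a0; move: mu_a; rewrite mu_a0 mul0rn => -[] /eqP.
by rewrite eq_sym oner_eq0.
Qed.

(** Two finite measures that agree on an intersection-stable family generating the Borel sets are
    equal; here these are [nu] and [c] times [mu], compared on cylinders. *)
Lemma uniform_measureE (nu : {measure set (padic_borel p) -> \bar R})
    (mu : probability (padic_borel p) R) (c : R) (B : set (padic_borel p)) :
  uniform_on_cylinders nu -> uniform_on_cylinders mu ->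
  nu setT = c%:E -> measurable B -> nu B = (c%:E * mu B)%E.
Proof.
move=> nu_unif mu_unif nuT mB.
have c_ge0 : 0 <= c by rewrite -lee_fin -nuT.
pose r := NngNum c_ge0; rewrite -/(mscale r mu B).
have nu_fin : fin_num_fun nu by apply: lty_fin_num_fun; rewrite nuT ltry.
apply: (measure_unique (@cylinders p) (fun=> setT)) => //.
- exact: borel_cylinders.
- exact: cylinders_setI.
- by move=> _; exact: cylinders_setT.
- by apply/seteqP; split=> // x _; exists 0%N.
2: by move=> _ /=; rewrite nuT ltry.
move=> _ [->|[k [a ->]]]; first by rewrite !measure0.
rewrite /= /mscale -[r%:num]/c -nuT (measure_setT_cylinder a nu_unif).
(* With [x] and [y] the masses of a cylinder under [nu] and [mu], and [n] the number of cylinders of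
   that level, [x *+ n] is the total mass [c]. *)
have aux (x y : \bar R) n : x \is a fin_num -> y \is a fin_num ->
    y *+ n = 1%E -> x = ((x *+ n)%R * y)%E.
  move=> /fineK <- /fineK <-; rewrite -!(raddfMn EFin) /= -EFinM => -[y1].
  by rewrite mulrnAl -mulrnAr y1 mulr1.
apply: aux; last exact: probability_cylinder.
  by apply: nu_fin; exact: measurable_cylinder.
by apply: fin_num_measure; exact: measurable_cylinder.
Qed.

End UniformMeasures.

(** * Ergodicity and transitivity of the induced maps *)

Section Ergodicity.
Variables (R : realType) (p : nat).
Hypothesis p_pr : prime p.
Variables (f : padic_int p -> padic_int p)
  (phi : forall k, k.+1.-tuple 'F_p -> 'F_p).
Hypothesis f_coord : coordinate_representation f phi.
Hypothesis phi_inj : forall k (a : k.-tuple 'F_p),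
  injective (subcoordinate phi a).
Variable mu : probability (padic_borel p) R.
Hypothesis mu_unif : uniform_on_cylinders mu.

Let g_inj k : injective (@induced_map p phi k) :=
  @induced_map_inj p phi phi_inj k.

Lemma digits_induced k x : digits k (f x) = induced_map phi (digits k x).
Proof.
apply: eq_from_tnth => i; rewrite !tnth_mktuple f_coord.
by congr (phi _); apply: eq_from_tnth => j; rewrite !tnth_mktuple.
Qed.

Lemma preimage_cylinder k (a : k.-tuple 'F_p) :
  f @^-1` cylinder (induced_map phi a) = cylinder a.
Proof.
apply/seteqP; split=> x; rewrite /cylinder /= digits_induced;
  first exact: g_inj.
by move=> ->.
Qed.

(** Preimages of generators suffice. The induced map is onto, so each cylinder is indexed by an
    image and pulls back to a single cylinder. *)
Lemma measurable_coordinate_fun :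
  measurable_fun setT (f : padic_borel p -> padic_borel p).
Proof.
apply: (@measurability _ _ (padic_borel p) (padic_borel p) setT f
  (@cylinders p)).
  exact: borel_cylinders.
move=> _ [_ [->|[k [a ->]]] <-].
  by rewrite preimage_set0 setI0.
rewrite setTI; have [h _ hK] := injF_bij (@g_inj k).
by rewrite -(hK a) preimage_cylinder; exact: measurable_cylinder.
Qed.

(** Pulling back permutes the cylinders of each level, so the image measure of [mu] is again
    uniform, hence equal to [mu]. *)
Lemma measure_preserving_coordinate :
  measure_preserving mu (f : padic_borel p -> padic_borel p).
Proof.
have f_meas := measurable_coordinate_fun.
split=> // A mA; pose F : {mfun padic_borel p >-> padic_borel p} :=
  mfun_Sub (mem_set f_meas).
pose nu : probability (padic_borel p) R := distribution mu F.
have nu_unif : uniform_on_cylinders nu.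
  move=> k a b; rewrite /nu /= /distribution /pushforward.
  have [h _ hK] := injF_bij (@g_inj k).
  by rewrite -(hK a) -(hK b) !preimage_cylinder.
have := uniform_measureE p_pr nu_unif mu_unif (probability_setT nu) mA.
by rewrite mul1e.
Qed.

Lemma ergodic_transitive k (a : k.-tuple 'F_p) :
  ergodic mu (f : padic_borel p -> padic_borel p) ->
  transitive_from (@induced_map p phi k) a.
Proof.
move=> [_ f_erg] b; suff : fconnect (@induced_map p phi k) a b.
  by move=> /iter_findex <-; exists (findex (@induced_map p phi k) a b).
apply: contrapT => /negP ab.
pose A : set (padic_borel p) :=
  digits k @^-1` [set c | fconnect (@induced_map p phi k) a c].
have mA : measurable A by exact: measurable_digits.
have a_gt0 := cylinder_measure_gt0 p_pr a mu_unif.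
have b_gt0 := cylinder_measure_gt0 p_pr b mu_unif.
have leA : (mu (cylinder a) <= mu A)%E.
  apply: le_measure; rewrite ?inE //; first exact: measurable_cylinder.
  by move=> x; rewrite /cylinder /A /= => ->.
have leAC : (mu (cylinder b) <= mu (~` A))%E.
  apply: le_measure; rewrite ?inE //; first exact: measurable_cylinder.
    exact: measurableC.
  by move=> x; rewrite /cylinder /A /= => ->; exact/negP.
have [] := f_erg A mA.
(* For an injective map of a finite type, [c] and its image lie on the same cycle, so [A] is exactly
   invariant. *)
- apply/seteqP; split=> x; rewrite /A /= digits_induced;
    by rewrite -(same_fconnect1_r (@g_inj k)).
- by move=> A0; move: (lt_le_trans a_gt0 leA); rewrite A0 ltxx.
- move=> A1; move: (lt_le_trans b_gt0 leAC).
  by rewrite probability_setC // A1 subee // ltxx.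
Qed.

Lemma transitive_ergodic (a : forall k, k.-tuple 'F_p) :
  (forall k, transitive_from (@induced_map p phi k) (a k)) ->
  ergodic mu (f : padic_borel p -> padic_borel p).
Proof.
move=> g_tr; have [f_meas f_pres] := measure_preserving_coordinate.
split=> // A mA fA; pose nu : {measure set _ -> \bar R} := mrestr mu mA.
(* Invariance of [A] lets [f] transport the mass of a cylinder within [A]; transitivity then spreads
   it over the whole level. *)
have nu_step k (b : k.-tuple 'F_p) :
    nu (cylinder (induced_map phi b)) = nu (cylinder b).
  rewrite /nu /= /mrestr -f_pres; last first.
    by apply: measurableI => //; exact: measurable_cylinder.
  by rewrite preimage_setI fA preimage_cylinder.
have nu_unif : uniform_on_cylinders nu.
  suff nu_a k (b : k.-tuple 'F_p) : nu (cylinder b) = nu (cylinder (a k)).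
    by move=> k b c; rewrite !nu_a.
  have [n <-] := g_tr k b; elim: n => [//|n IH].
  by rewrite iterS nu_step.
have A_fin : mu A \is a fin_num by exact: fin_num_measure.
have nuT : nu setT = (fine (mu A))%:E by rewrite fineK // /nu /= /mrestr setTI.
(* Evaluated at [A] itself, the product formula says that [mu A] equals its own square. *)
have := uniform_measureE p_pr nu_unif mu_unif nuT mA.
rewrite /nu /= /mrestr setIid -(fineK A_fin) -EFinM => -[] /eqP.
rewrite -subr_eq0 -{1}[fine _]mulr1 -mulrBr mulf_eq0 subr_eq0 [1 == _]eq_sym.
by case/orP=> /eqP ->; [left|right].
Qed.

End Ergodicity.

Theorem theorem3p6 (R : realType) (p : nat) (p_prime : prime p)
    (mu : probability (padic_borel p) R) (mu_haar : haar_probability mu)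
    (f : padic_int p -> padic_int p) (f_compat : compatible f)
    (phi : forall k, k.+1.-tuple 'F_p -> 'F_p)
    (f_coord : coordinate_representation f phi)
    (phi0_perm : bijective (subcoordinate phi [tuple]))
    (phi_perm : forall (k : nat) (a : k.-tuple 'F_p), (0 < k)%N ->
      bijective (subcoordinate phi a)) :
  ergodic mu f <->
  transitive_perm (subcoordinate phi [tuple]) /\
  (forall k : nat, (0 < k)%N ->
     transitive_perm (fibre_return_map phi [tuple of nseq k 0])).
Proof.
have phi_inj k (a : k.-tuple 'F_p) : injective (subcoordinate phi a).
  case: k a => [|k] a; last exact/bij_inj/phi_perm.
  by rewrite [a]tuple0; exact: bij_inj.
have mu_unif := haar_uniform p_prime mu_haar.
(* Since [p ^ 0] is 1, the return map at level 0 has a single factor, which lets condition (1) be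
   the case [k = 0] of condition (2). *)
have F0 : fibre_return_map phi [tuple of nseq 0 0] = subcoordinate phi [tuple].
  by rewrite [X in fibre_return_map _ X]tuple0.
have fibres := transitive_from_fibres phi_inj p_prime.
split=> [f_erg|[phi0_tr F_tr]].
  have F_tr : forall k,
      transitive_perm (fibre_return_map phi [tuple of nseq k 0]).
    apply/fibres => k.
    exact: (ergodic_transitive p_prime f_coord phi_inj mu_unif).
  by split=> [|k _]; [rewrite -F0|].
apply: (transitive_ergodic p_prime f_coord phi_inj mu_unif).
by apply/fibres => -[|k]; [rewrite F0|exact: F_tr].
Qed.
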